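(* The set of rigid groups $\{G \in \mathrm{TFAB}_\omega : \mathrm{Aut}(G) = \{\mathrm{id}_G, -\mathrm{id}_G\}\}$ is a complete co-analytic subset of $\mathrm{TFAB}_\omega$.
   Context: $\mathrm{TFAB}_\omega$ is the Borel space of torsion-free abelian groups with domain $\omega = \mathbb{N}$: the set of all abelian torsion-free group structures with underlying set $\omega$, with the standard Borel structure inherited from the usual product space of structures with domain $\omega$ in the language of groups. An abelian group $G$ is called rigid when $\mathrm{Aut}(G) = \{\mathrm{id}_G, -\mathrm{id}_G\}$. A subset $A$ of a standard Borel space $Z$ is complete co-analytic in $Z$ if $A$ is co-analytic and for every standard Borel space $Y$ and every co-analytic $B \subseteq Y$ there is a Borel function $F : Y \to Z$ such that $B = F^{-1}(A)$. *)

(* Defs.v *)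
From HB Require Import structures.
From mathcomp Require Import all_boot all_order all_algebra.
From mathcomp Require Import all_classical all_reals all_analysis.

Set Implicit Arguments.
Unset Strict Implicit.
Unset Printing Implicit Defensive.

Local Open Scope classical_set_scope.

(** Polish and standard Borel spaces.  A measurable space is a type [Y] with a
    set system [S] on it rather than a [measurableType], and completeness is
    spelled out rather than taken from [completeType], because those library
    structures are pointed and would exclude the empty space. *)

Definition complete_metric (R : realType) (T : metricType R) : Prop :=
  forall F : set_system T, ProperFilter F -> cauchy F -> exists l : T, F --> l.

Definition separable (T : topologicalType) : Prop :=
  exists D : set T, countable D /\ dense D.

Definition polish (R : realType) (T : metricType R) : Prop :=
  complete_metric T /\ separable T.

Definition borel (T : topologicalType) : set_system T := <<s open >>.

Definition borel_iso (Y : Type) (S : set_system Y)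
    (T : topologicalType) (h : Y -> T) : Prop :=
  bijective h /\ forall B : set T, borel B <-> S (h @^-1` B).

Definition standard_borel (R : realType) (Y : Type) (S : set_system Y) : Prop :=
  exists (T : metricType R) (h : Y -> T), polish T /\ borel_iso S h.

Definition borel_fun (Y Z : Type) (SY : set_system Y) (SZ : set_system Z)
    (F : Y -> Z) : Prop :=
  forall C : set Z, SZ C -> SY (F @^-1` C).

(** A continuous image of a Polish space; [P] may be empty, so [set0] is
    analytic. *)
Definition analytic_in_polish (R : realType) (T : metricType R) (A : set T) :
    Prop :=
  exists (P : metricType R) (f : P -> T),
    [/\ polish P, continuous f & range f = A].

(** In a standard Borel space, analyticity is tested in a Polish space that
    realizes the Borel structure; the choice of that space is immaterial. *)
Definition analytic (R : realType) (Y : Type) (S : set_system Y) (A : set Y) :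
    Prop :=
  exists (T : metricType R) (h : Y -> T),
    [/\ polish T, borel_iso S h & analytic_in_polish (h @` A)].

Definition coanalytic (R : realType) (Y : Type) (S : set_system Y)
    (A : set Y) : Prop :=
  analytic R S (~` A).

Definition complete_coanalytic (R : realType) (Z : Type) (SZ : set_system Z)
    (A : set Z) : Prop :=
  coanalytic R SZ A /\
  forall (Y : Type) (SY : set_system Y) (B : set Y),
    standard_borel R SY -> coanalytic R SY B ->
    exists F : Y -> Z, borel_fun SY SZ F /\ B = F @^-1` A.

(** Structures with domain [nat] in the language of groups (binary operation,
    inverse, neutral element), with the product of the discrete topologies. *)
Definition structure : Type :=
  ({ptws nat * nat -> nat} * {ptws nat -> nat} * nat)%type.

Definition sadd (M : structure) (x y : nat) : nat := M.1.1 (x, y).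
Definition sopp (M : structure) (x : nat) : nat := M.1.2 x.
Definition szero (M : structure) : nat := M.2.

Definition abelian_group (M : structure) : Prop :=
  [/\ associative (sadd M), commutative (sadd M),
      left_id (szero M) (sadd M) & left_inverse (szero M) (sopp M) (sadd M)].

Definition torsion_free (M : structure) : Prop :=
  forall (n : nat) (x : nat), (0 < n)%N ->
    iter n (sadd M x) (szero M) = szero M -> x = szero M.

Definition TFAB : set structure :=
  [set M | abelian_group M /\ torsion_free M].

(** The trace on [TFAB] of the Borel sets of the space of structures. *)
Definition TFAB_borel : set_system TFAB :=
  preimage_set_system setT (set_val : TFAB -> structure)
    (@borel ({ptws nat * nat -> nat} * {ptws nat -> nat} * nat)%type).

Definition Aut (M : structure) : set (nat -> nat) :=
  [set f | bijective f /\ {morph f : x y / sadd M x y}].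

Definition rigid : set TFAB :=
  [set G | Aut (set_val G) = [set idfun; sopp (set_val G)]].

(* Main.v *)
Require Import Defs.
From HB Require Import structures.
From mathcomp Require Import all_boot all_order all_algebra.
From mathcomp Require Import all_classical all_reals all_analysis.
From mathcomp Require Import lra zify.

(** Rigidity is co-analytic because its failure has a witness made of integers:
    an automorphism, its inverse, a point that the automorphism moves and a
    point that it does not send to its opposite.  Torsion-free abelian groups
    on [nat], with or without such a witness, form a closed subset of a
    countable power of [nat] and hence a Polish space ([obs_polish]), and the
    non-rigid groups are a projection ([rigid_coanalytic]).

    For completeness let [f : P -> T] be continuous with [P] Polish.  Each
    finite sequence [s] names an intersection of balls of [P] of shrinking
    radius, and [s] is put into the tree of [t] when [t] lies in the closure of
    the image of this intersection.  Completeness of [P] and continuity of [f]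
    make [t] a value of [f] exactly when its tree has an infinite branch
    ([range_branch], [branch_range]), and membership of a given [s] in the tree
    is a closed condition on [t].  It remains to attach to a tree [S], in a
    Borel way, a torsion-free abelian group which is rigid exactly when [S] has
    no infinite branch.

    The nodes of [S] are finite sequences, to which is adjoined one fixed
    infinite path, the chain of the sequences of zeros.  The group [grp S] lies
    between the integral and the rational finitely supported vectors on [S],
    with basis vectors [e s].  It is cut out prime by prime: every prime [p] is
    given a subspace, whose elements in the group become those divisible there
    by all powers of [p], so that every endomorphism preserves it.  Three kinds of
    subspaces occur:
    - the span of all [e s] with [s] of length [n];
    - the line of [e s], for [s] outside the chain;
    - the span of all [e s - e s'], with [s'] a child of [s] of length [n.+1].
    An endomorphism [phi] thus preserves lengths, multiplies [e s] by a scalar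
    when [s] is outside the chain, and commutes with passing from a node to its
    parent.  The root is alone on its level, so [phi] acts on it by a scalar
    [a], and by the last property [a] is also the scalar of all nodes outside
    the chain.  If the image of the chain vector [y_n] of level [n] has a
    nonzero coordinate at a node [t] outside the chain, then the image of
    [y_(n+1)] has a nonzero coordinate at a child of [t], and so on: this
    builds a branch ([branch_above]).  Without a branch, [phi] is thus
    multiplication by [a]; as each prime leaves some chain vector outside
    its subspace, [a] is an integer, and for an automorphism it is [1] or [-1]
    ([automorphism_scalar]).  If conversely [eta] is a branch, then sending
    [y_n] to [2 e(eta_n) - y_n], and fixing all other basis vectors, preserves
    the three kinds of subspaces, and is an involution other than the two
    signs. *)

Set Implicit Arguments.
Unset Strict Implicit.
Unset Printing Implicit Defensive.

Import Order.TTheory GRing.Theory Num.Theory.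
Local Open Scope classical_set_scope.
Local Open Scope ring_scope.

(** * Rationals integral at a prime *)

Definition pint (p : nat) (r : rat) : Prop :=
  exists2 d : nat, coprime p d & d%:R * r \is a Num.int.

Lemma pint_int p r : r \is a Num.int -> pint p r.
Proof. by move=> ri; exists 1%N; rewrite ?coprimen1 ?mul1r. Qed.

Lemma pint_add p r s : pint p r -> pint p s -> pint p (r + s).
Proof.
move=> [d pd dr] [c pc cs]; exists (d * c)%N; first by rewrite coprimeMr pd.
have -> : (d * c)%:R * (r + s) = c%:R * (d%:R * r) + d%:R * (c%:R * s).
  by rewrite natrM mulrDr !mulrA [c%:R * _]mulrC.
by rewrite rpredD // rpredM ?natr_int.
Qed.

Lemma pint_mul p r s : pint p r -> pint p s -> pint p (r * s).
Proof.
move=> [d pd dr] [c pc cs]; exists (d * c)%N; first by rewrite coprimeMr pd.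
by rewrite natrM mulrACA rpredM.
Qed.

Lemma pint_sum p n (F : 'I_n -> rat) :
  (forall i, pint p (F i)) -> pint p (\sum_i F i).
Proof.
move=> hF; apply: (big_ind (pint p)) => //; last exact: pint_add.
by apply: pint_int; rewrite rpred0.
Qed.

Lemma pint_div p q k r : coprime p q -> (0 < q)%N -> pint p r ->
  pint p (q%:R ^- k * r).
Proof.
move=> pq q0 [d pd dr]; exists (d * q ^ k)%N.
  by rewrite coprimeMr pd coprimeXr.
suff -> : (d * q ^ k)%:R * (q%:R ^- k * r) = d%:R * r by [].
rewrite natrM natrX -mulrA; congr (_ * _); rewrite mulrA divff ?mul1r //.
by rewrite expf_neq0 // pnatr_eq0 -lt0n.
Qed.

Lemma pint_denq p r : pint p r -> coprime p `|denq r|.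
Proof.
move=> [d pd /intrP [z hz]].
have /eqP : d%:R * numq r = denq r * z :> int.
  apply: (@intr_inj rat); rewrite !intrM.
  rewrite -hz -{3}[r]divq_num_den rmorph_nat mulrCA; congr (_ * _); rewrite mulrC divfK //.
  by rewrite intr_eq0 denq_eq0.
move=> /eqP/(congr1 absz); rewrite !abszM => H.
have : (`|denq r| %| d)%N.
  rewrite -(@Gauss_dvdl _ _ `|numq r|); last first.
    by rewrite coprime_sym coprime_num_den.
  by move: H; rewrite natz absz_nat => ->; rewrite dvdn_mulr.
by move=> /coprime_dvdr; apply.
Qed.

(** The denominator of [r] is prime to every prime. *)
Lemma int_of_pint r : (forall p, prime p -> pint p r) -> r \is a Num.int.
Proof.
move=> H; rewrite Qint_def -[denq r]absz_denq; apply/eqP; congr Posz.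
apply/eqP; apply: contraT => d1.
have d0 : (0 < `|denq r|)%N by rewrite absz_gt0 denq_eq0.
have /H/pint_denq := @pdiv_prime `|denq r|%N ltac:(by lia).
rewrite prime_coprime ?pdiv_dvd //; apply: pdiv_prime; lia.
Qed.

(** Integrality at [p] of [r / p ^ k] makes [p ^ k] divide the numerator. *)
Lemma pint_divisible_eq0 p r : prime p ->
  (forall k, pint p (p%:R ^- k * r)) -> r = 0.
Proof.
move=> pp H; apply/eqP; rewrite -numq_eq0 -absz_eq0; apply: contraT => r0.
have p0 : (p%:R : rat) != 0 by rewrite pnatr_eq0 -lt0n prime_gt0.
pose k := (logn p `|numq r|).+1.
have [d pd /intrP [z hz]] := H k.
have E : d%:R * numq r = (p ^ k)%N%:Z * denq r * z :> int.
  apply: (@intr_inj rat); rewrite !intrM.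
  rewrite -hz -{3}[r]divq_num_den rmorph_nat -pmulrn natrX.
  have den0 : (denq r)%:~R != 0 :> rat by rewrite intr_eq0 denq_eq0.
  rewrite [RHS]mulrCA; congr (_ * _).
  by rewrite mulrACA divff ?expf_neq0 // mul1r mulrC divfK.
have : (p ^ k %| d * `|numq r|)%N.
  by move/(congr1 absz): E; rewrite !abszM natz !absz_nat => ->; rewrite -mulnA dvdn_mulr.
rewrite Gauss_dvdr ?coprimeXl // pfactor_dvdn ?lt0n // /k.
by rewrite ltnn.
Qed.

(** * Counting the elements of a set of naturals *)

Section Rank.
Variable A : set nat.

Definition rank (n : nat) : nat := count (fun m => `[< A m >]) (iota 0 n).

Lemma rankS n : rank n.+1 = (rank n + `[< A n >])%N.
Proof. by rewrite /rank -addn1 iotaD count_cat /= add0n addn0. Qed.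

Lemma rank_le m n : (m <= n)%N -> (rank m <= rank n)%N.
Proof.
by move=> /subnKC <-; rewrite /rank iotaD count_cat leq_addr.
Qed.

Lemma rank_inj m n : A m -> A n -> rank m = rank n -> m = n.
Proof.
have key i j : A i -> (i < j)%N -> (rank i < rank j)%N.
  by move=> Ai /rank_le; rewrite rankS (asboolT Ai) addn1.
move=> Am An E; case: (ltngtP m n) => // /key; rewrite E ltnn.
  by move=> /(_ Am).
by move=> /(_ An).
Qed.

Hypothesis A_unbounded : forall n, exists2 m, (n <= m)%N & A m.

(** With [rank_inj], this turns an unbounded set of naturals into a copy of
    [nat].  It serves both to index the primes and to enumerate the groups; the
    enumeration is explicit so that it depends on the set in a Borel way. *)
Lemma rank_surj k : exists2 m, A m & rank m = k.
Proof.
have ex : exists n, (k < rank n)%N.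
  elim: k => [|k [n kn]].
    by have [m _ Am] := A_unbounded 0; exists m.+1; rewrite rankS (asboolT Am) addn1.
  have [m nm Am] := A_unbounded n; exists m.+1.
  by rewrite rankS (asboolT Am) addn1 ltnS (leq_trans kn) // rank_le.
case: (ex_minnP ex) => -[//|n] kn nmin.
have le_k : (rank n <= k)%N by rewrite leqNgt; apply/negP => /nmin; rewrite ltnn.
move: kn; rewrite rankS; case: asboolP => [An|_]; last by lia.
by exists n => //; lia.
Qed.

End Rank.

(** * Finitely supported rational vectors indexed by finite sequences *)

(** Nodes are read from the tip to the root: the children of [s] are the
    [k :: s], and the parent of [s] is [behead s].  Since finite sequences of
    naturals are in bijection with the naturals, polynomials are the finitely
    supported families indexed by nodes. *)
Notation node := (seq nat).
Notation vect := {poly rat}.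

Definition e (s : node) : vect := 'X^(CodeSeq.code s).
Definition entry (v : vect) (s : node) : rat := v`_(CodeSeq.code s).

Lemma entry_e s t : entry (e s) t = (s == t)%:R.
Proof.
rewrite /entry coefXn eq_sym; congr (nat_of_bool _)%:R.
by rewrite (can_eq CodeSeq.codeK).
Qed.

Lemma entryD u v t : entry (u + v) t = entry u t + entry v t.
Proof. exact: coefD. Qed.
Lemma entryN v t : entry (- v) t = - entry v t.
Proof. exact: coefN. Qed.
Lemma entryZ a v t : entry (a *: v) t = a * entry v t.
Proof. exact: coefZ. Qed.
Lemma entry0 t : entry 0 t = 0.
Proof. exact: coef0. Qed.

Lemma vectP u v : entry u =1 entry v -> u = v.
Proof.
move=> H; apply/polyP => i; rewrite -[i]CodeSeq.decodeK; exact: H.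
Qed.

Section Lin.
Variable g : node -> vect.

Definition lin (v : vect) : vect :=
  \sum_(i < size v) v`_i *: g (CodeSeq.decode i).

Lemma lin_wide n (v : vect) : (size v <= n)%N ->
  lin v = \sum_(i < n) v`_i *: g (CodeSeq.decode i).
Proof.
move=> vn; rewrite /lin (big_ord_widen _ (fun i => v`_i *: g (CodeSeq.decode i)) vn).
rewrite big_mkcond; apply: eq_bigr => i _; case: ltnP => // h.
by rewrite nth_default // scale0r.
Qed.

Lemma lin_is_linear : linear lin.
Proof.
move=> a u v; pose n := maxn (size u) (size v).
have un : (size u <= n)%N by rewrite leq_maxl.
have vn : (size v <= n)%N by rewrite leq_maxr.
have wn : (size (a *: u + v)%R <= n)%N.
  rewrite (leq_trans (size_polyD _ _)) // geq_max vn andbT.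
  exact: leq_trans (size_scale_leq _ _) un.
rewrite (lin_wide un) (lin_wide vn) (lin_wide wn) scaler_sumr -big_split /=.
by apply: eq_bigr => i _; rewrite coefD coefZ scalerDl scalerA.
Qed.

HB.instance Definition _ := GRing.isLinear.Build rat vect vect _ lin lin_is_linear.

Lemma lin_e s : lin (e s) = g s.
Proof.
rewrite /lin size_polyXn big_ord_recr /= coefXn eqxx scale1r CodeSeq.codeK.
rewrite big1 ?add0r // => i _; rewrite coefXn.
by have /ltn_eqF -> := ltn_ord i; rewrite scale0r.
Qed.

Lemma entry_lin (v : vect) t :
  entry (lin v) t =
  \sum_(i < size v) entry v (CodeSeq.decode i) * entry (g (CodeSeq.decode i)) t.
Proof.
rewrite /entry /lin coef_sum; apply: eq_bigr => i _.
by rewrite coefZ CodeSeq.decodeK.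
Qed.

End Lin.

Lemma vect_sum (v : vect) :
  v = \sum_(i < size v) entry v (CodeSeq.decode i) *: e (CodeSeq.decode i).
Proof.
rewrite -[LHS]coefK poly_def /e /entry.
by under [RHS]eq_bigr do rewrite CodeSeq.decodeK.
Qed.

Lemma linear_ext (f g : {linear vect -> vect}) v :
  (forall s, entry v s != 0 -> f (e s) = g (e s)) -> f v = g v.
Proof.
move=> H; rewrite (vect_sum v) !linear_sum; apply: eq_bigr => i _.
rewrite !linearZ /=; have [->|/H ->//] := eqVneq (entry v (CodeSeq.decode i)) 0.
by rewrite !scale0r.
Qed.

(** * The group of a tree *)

Lemma primes_unbounded n : exists2 m, (n <= m)%N & [set p | prime p] m.
Proof. by have [p np pp] := prime_above n; exists p => //=; rewrite ltnW. Qed.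

(** The nodes of the infinite path adjoined to every tree; the root is one of
    them. *)
Definition chain (s : node) : bool := all (pred1 0%N) s.

Lemma chain_behead s : chain s -> chain (behead s).
Proof. by case: s => //= k s /andP[]. Qed.

Lemma chainE s : chain s = (s == nseq (size s) 0%N).
Proof. exact/all_pred1P/eqP. Qed.

(** The possible divisible parts at a prime, given below as the kernels of
    [quot]: the span of a level, the line of a node, and the span of the
    differences between the nodes of level [n] and their children. *)
Inductive constraint := Level of nat | Single of node | Merge of nat.

(** All that matters is that every constraint has a code ([constraint_at_surj]);
    the other codes repeat an existing constraint, so that every prime carries
    one. *)
Definition constraint_of_code (s : node) : constraint :=
  match s with
  | [:: 0; n] => Level n
  | [:: 1, 1 & s'] => Single s'
  | [:: 1, 0 & s'] => Merge (size s')
  | _ => Level 0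
  end%N.

Definition constraint_at (p : nat) : constraint :=
  constraint_of_code (CodeSeq.decode (rank [set q | prime q] p)).

Lemma constraint_at_surj c : exists2 p, prime p & constraint_at p = c.
Proof.
have [s <-] : exists s, constraint_of_code s = c.
  case: c => [n|s|n]; [exists [:: 0; n]%N|exists [:: 1, 1 & s]%N|] => //.
  by exists [:: 1, 0 & nseq n 0]%N; rewrite /= size_nseq.
have [p pp E] := rank_surj primes_unbounded (CodeSeq.code s).
by exists p => //; rewrite /constraint_at E CodeSeq.codeK.
Qed.

Definition keep (P : pred node) (s : node) : vect := if P s then e s else 0.

(** The lines of the chain nodes are not prescribed, as the involution built from
    a branch moves them; [Single u] with [u] on the chain has zero kernel. *)
Definition quot_gen (c : constraint) (s : node) : vect :=
  match c with
  | Level n => keep (fun s => size s != n) s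
  | Single u => keep (fun s => chain s || (s != u)) s
  | Merge n => e (if size s == n.+1 then behead s else s)
  end.

Definition quot c : vect -> vect := lin (quot_gen c).
HB.instance Definition _ c := GRing.Linear.on (quot c).

Lemma quot_e c s : quot c (e s) = quot_gen c s.
Proof. exact: lin_e. Qed.

Lemma entry_keep P v t : entry (lin (keep P) v) t = if P t then entry v t else 0.
Proof.
rewrite entry_lin /keep; case: ifP => Pt; last first.
  rewrite big1 // => i _; case: ifP => Pi; last by rewrite entry0 mulr0.
  by rewrite entry_e; case: eqP => [E|]; [rewrite E Pt in Pi|rewrite mulr0].
rewrite [in RHS](vect_sum v) /entry coef_sum; apply: eq_bigr => i _.
rewrite coefZ -!/(entry _ _); case: ifP => // Pi.
by rewrite entry_e entry0; case: eqP => // E; rewrite E Pt in Pi.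
Qed.

Definition intvect (v : vect) := forall t, entry v t \is a Num.int.

Lemma intvect_e s : intvect (e s).
Proof. by move=> t; rewrite entry_e natr_int. Qed.

Lemma intvect0 : intvect 0.
Proof. by move=> t; rewrite entry0 rpred0. Qed.

Lemma intvect_quot_gen c s : intvect (quot_gen c s).
Proof.
case: c => [n|u|n] /=; rewrite /keep; try case: ifP => _;
  first [exact: intvect_e|exact: intvect0].
Qed.

Definition pintvect p (v : vect) := forall t, pint p (entry v t).

Lemma pintvect_lin p g v : (forall s, intvect (g s)) ->
  pintvect p v -> pintvect p (lin g v).
Proof.
move=> gi vp t; rewrite entry_lin; apply: pint_sum => i.
by apply: pint_mul; [exact: vp | apply: pint_int; exact: gi].
Qed.

Lemma pintvect_int p v : intvect v -> pintvect p v.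
Proof. by move=> vi t; apply: pint_int. Qed.

Section Group.
Variable S : set node.

Definition supported (v : vect) := forall s, entry v s != 0 -> S s.

(** At the prime [p], this is the sum of the [p]-integral vectors and the kernel of
    [quot (constraint_at p)].  The quotient maps do not depend on [S], hence
    membership of a given vector depends on [S] through its support only. *)
Definition grp : set vect := [set v | supported v /\
  forall p, prime p -> pintvect p (quot (constraint_at p) v)].

Lemma grp0 : grp 0.
Proof.
split=> [s|p _ t]; first by rewrite entry0 eqxx.
by apply: pint_int; rewrite linear0 entry0 rpred0.
Qed.

Lemma grpD u v : grp u -> grp v -> grp (u + v).
Proof.
move=> [us up] [vs vp]; split=> [s|p pp t]; last first.
  by rewrite linearD entryD; apply: pint_add; [exact: up|exact: vp].
rewrite entryD; have [->|/us//] := eqVneq (entry u s) 0.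
by rewrite add0r => /vs.
Qed.

Lemma grpZint a v : a \is a Num.int -> grp v -> grp (a *: v).
Proof.
move=> ai [vs vp]; split=> [s|p pp t].
  by rewrite entryZ mulf_eq0 negb_or => /andP[_ /vs].
by rewrite linearZ /= entryZ; apply: pint_mul; [exact: pint_int|exact: vp].
Qed.

Lemma grpN v : grp v -> grp (- v).
Proof. by move=> gv; rewrite -scaleN1r; apply: grpZint. Qed.

Lemma grpMn v n : grp v -> grp (v *+ n).
Proof. by move=> gv; rewrite -scaler_nat; apply: grpZint => //; rewrite natr_int. Qed.

Lemma grp_intvect v : supported v -> intvect v -> grp v.
Proof.
move=> vs vi; split=> // p pp; apply: pintvect_lin; first exact: intvect_quot_gen.
exact: pintvect_int.
Qed.

Lemma grp_e s : S s -> grp (e s).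
Proof.
move=> Ss; apply: grp_intvect; last exact: intvect_e.
by move=> t; rewrite entry_e; case: (s =P t) => [<-|_] //; rewrite eqxx.
Qed.

(** The kernel of the map attached to [p] consists, inside the group, of the
    elements divisible by all powers of [p]: dividing by [p] affects no
    integrality at another prime, and nothing nonzero stays integral at [p]
    under division by all powers of [p]. *)
Lemma quot_eq0P p v : prime p -> grp v ->
  quot (constraint_at p) v = 0 <-> forall k, grp (p%:R ^- k *: v).
Proof.
move=> pp gv; split => [v0 k|H].
  case: gv => vs vp; split=> [s|q qp t].
    by rewrite entryZ mulf_eq0 negb_or => /andP[_ /vs].
  rewrite linearZ /=; have [->|qNp] := eqVneq q p.
    by rewrite v0 scaler0; apply: pint_int; rewrite entry0 rpred0.
  rewrite entryZ; apply: pint_div; last exact: vp.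
    by rewrite prime_coprime // dvdn_prime2.
  exact: prime_gt0.
apply/vectP => t; rewrite entry0; apply: (@pint_divisible_eq0 p) => // k.
by have [_ /(_ p pp t)] := H k; rewrite linearZ /= entryZ.
Qed.

End Group.

(** * Without a branch the automorphisms are the two signs *)

(** Outside the adjoined path, nodes have no entry [0]; the path thus leaves no
    room for other children of its nodes, except at the root. *)
Record based_tree (S : set node) : Prop := BasedTree {
  based_behead : forall s, S s -> S (behead s);
  based_chain : forall s, chain s -> S s;
  based_off_chain : forall s, S s -> chain s || (0%N \notin s) }.

Definition branch (S : set node) (eta : nat -> node) : Prop := forall n,
  [/\ size (eta n) = n, S (eta n), behead (eta n.+1) = eta n
    & (0 < n)%N -> ~~ chain (eta n)].

Definition push : vect -> vect := lin (fun s => e (behead s)).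
HB.instance Definition _ := GRing.Linear.on push.

Lemma push_e s : push (e s) = e (behead s).
Proof. exact: lin_e. Qed.

(** The coordinate of [push v] at [t] is the sum of those of [v] at the children
    of [t] (and at [t] itself for the root). *)
Lemma entry_push_neq0 v t : entry (push v) t != 0 ->
  exists2 s, behead s = t & entry v s != 0.
Proof.
move=> vt; apply: contrapT => /forall2NP H; move: vt; rewrite entry_lin big1 ?eqxx //.
move=> i _; rewrite entry_e; case: (_ =P t) => [E|_]; last by rewrite mulr0.
case: (H (CodeSeq.decode i)) => // /negP; rewrite negbK => /eqP ->.
by rewrite mul0r.
Qed.

Lemma quot_merge_same n v : (forall s, entry v s != 0 -> size s = n) ->
  quot (Merge n) v = v.
Proof.
move=> vn; rewrite (linear_ext (f := quot (Merge n)) (g := idfun)) // => s /vn E.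
rewrite [LHS]quot_e /= E; case: eqP => //; lia.
Qed.

Lemma quot_merge_push n v : (forall s, entry v s != 0 -> size s = n.+1) ->
  quot (Merge n) v = push v.
Proof.
move=> vn; apply: linear_ext => s /vn E.
by rewrite [LHS]quot_e [RHS]push_e /= E eqxx.
Qed.

Section Endo.
Variables (S : set node) (phi : vect -> vect).
Hypothesis S_based : based_tree S.
Hypothesis phi_grp : forall v, grp S v -> grp S (phi v).
Hypothesis phiD : forall u v, grp S u -> grp S v -> phi (u + v) = phi u + phi v.

Lemma endo0 : phi 0 = 0.
Proof.
have := phiD (grp0 S) (grp0 S); rewrite addr0 => /eqP.
by rewrite -subr_eq subrr => /eqP <-.
Qed.

Lemma endoN v : grp S v -> phi (- v) = - phi v.
Proof.
move=> gv; have := phiD (grpN gv) gv; rewrite addNr endo0 => /esym/eqP.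
by rewrite addr_eq0 => /eqP.
Qed.

Lemma endoMn v n : grp S v -> phi (v *+ n) = phi v *+ n.
Proof.
move=> gv; elim: n => [|n IH]; first by rewrite !mulr0n endo0.
by rewrite !mulrS phiD ?IH //; apply: grpMn.
Qed.

Lemma endoZ a v : a \is a Num.int -> grp S v -> phi (a *: v) = a *: phi v.
Proof.
move=> /intrP[[n|n] ->] gv; first by rewrite -pmulrn !scaler_nat endoMn.
rewrite NegzE mulrNz -pmulrn !scaleNr !scaler_nat endoN ?endoMn //.
exact: grpMn.
Qed.

Lemma endo_sum n (F : 'I_n -> vect) : (forall i, grp S (F i)) ->
  phi (\sum_i F i) = \sum_i phi (F i).
Proof.
move=> gF; suff [] : grp S (\sum_i F i) /\ phi (\sum_i F i) = \sum_i phi (F i) by [].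
apply: (big_ind2 (fun x y => grp S x /\ phi x = y)) => //.
  by split; [exact: grp0|exact: endo0].
by move=> u1 v1 u2 v2 [gu <-] [gv <-]; split; [exact: grpD|exact: phiD].
Qed.

(** Endomorphisms preserve divisibility by all powers of a prime. *)
Lemma quot_endo_eq0 c v : grp S v -> quot c v = 0 -> quot c (phi v) = 0.
Proof.
have [p pp <-] := constraint_at_surj c => gv /(quot_eq0P pp gv) H.
apply/(quot_eq0P pp (phi_grp gv)) => k.
have p0 : (p%:R ^+ k : rat) != 0 by rewrite expf_neq0 // pnatr_eq0 -lt0n prime_gt0.
suff -> : p%:R ^- k *: phi v = phi (p%:R ^- k *: v) by apply: phi_grp.
have {1}-> : v = p%:R ^+ k *: (p%:R ^- k *: v) by rewrite scalerA divff // scale1r.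
by rewrite endoZ // ?rpredX ?natr_int // scalerA mulVf // scale1r.
Qed.

Lemma endo_level s t : S s -> entry (phi (e s)) t != 0 -> size t = size s.
Proof.
move=> Ss; apply: contraNeq => st.
have : quot (Level (size s)) (phi (e s)) = 0.
  by apply: quot_endo_eq0; [exact: grp_e|rewrite quot_e /= /keep eqxx].
by move=> /(congr1 (entry^~ t)); rewrite entry_keep st entry0 => ->.
Qed.

Lemma endo_off_chain s : S s -> ~~ chain s ->
  phi (e s) = entry (phi (e s)) s *: e s.
Proof.
move=> Ss sN; apply/vectP => t; rewrite entryZ entry_e.
case: (s =P t) => [<-|/eqP st]; first by rewrite mulr1.
have : quot (Single s) (phi (e s)) = 0.
  apply: quot_endo_eq0; first exact: grp_e.
  by rewrite quot_e /= /keep eqxx (negPf sN).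
move=> /(congr1 (entry^~ t)); rewrite entry_keep entry0 eq_sym st orbT => ->.
by rewrite mulr0.
Qed.

(** [e s - e (behead s)] is in the kernel of the [Merge] constraint of its level,
    and so is its image; as images stay on their levels, [Merge] acts on the
    two parts as [push] and as the identity. *)
Lemma endo_push s : S s -> s != [::] -> push (phi (e s)) = phi (e (behead s)).
Proof.
case: s => // k s Ss _; have Sb := based_behead S_based Ss.
rewrite -(@quot_merge_push (size s)); last by move=> u /(endo_level Ss).
rewrite -[RHS](@quot_merge_same (size s)); last by move=> u /(endo_level Sb).
apply/eqP; rewrite -subr_eq0 -linearB; apply/eqP.
rewrite -endoN; last exact: grp_e.
rewrite -phiD; [|exact: grp_e|by apply: grpN; apply: grp_e].
apply: quot_endo_eq0; first by apply: grpD; [exact: grp_e|apply: grpN; exact: grp_e].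
rewrite linearB /= !quot_e /= eqxx.
by case: eqP => [|_]; [lia|rewrite subrr].
Qed.

Let a := entry (phi (e [::])) [::].

Lemma endo_root : phi (e [::]) = a *: e [::].
Proof.
apply/vectP => t; rewrite entryZ entry_e; case: t => [|k t]; first by rewrite mulr1.
rewrite mulr0; apply/eqP; apply: contraT => /endo_level H.
by have := H (based_chain S_based (isT : chain [::])).
Qed.

(** By [endo_push] the scalar of a node is that of its parent. *)
Lemma endo_scalar_off_chain s : S s -> ~~ chain s -> phi (e s) = a *: e s.
Proof.
elim: s => // k s IH Ss sN; have Sb := based_behead S_based Ss.
have ks := endo_off_chain Ss sN; rewrite ks; congr (_ *: _).
have E := endo_push Ss isT; rewrite ks linearZ /= push_e /= in E.
have : phi (e s) = a *: e s.
  have [cs|/IH->//] := boolP (chain s).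
  case/orP: (based_off_chain S_based Ss) => [/negPn|]; first by rewrite sN.
  case: s {IH Ss sN Sb E ks} cs => [_ _|j s /=]; first exact: endo_root.
  by case/andP=> /eqP-> _; rewrite !inE /= orbT.
by rewrite -E => /(congr1 (entry^~ s)); rewrite !entryZ entry_e eqxx !mulr1.
Qed.

Lemma based_drop n s : S s -> S (drop n s).
Proof.
elim: n s => [|n IH] s Ss; first by rewrite drop0.
by case: s Ss => // k s /(based_behead S_based) /= /IH.
Qed.

Lemma based_nseq n : S (nseq n 0%N).
Proof. by apply: (based_chain S_based); rewrite chainE size_nseq. Qed.

Lemma endo_supported s : S s -> supported S (phi (e s)).
Proof. by move=> Ss; have [] := phi_grp (grp_e Ss). Qed.

(** A nonzero coordinate of the image of a chain vector, taken at [t], is the sum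
    of the coordinates at the children of [t] of the image of the next chain
    vector, so it can be followed upwards forever. *)
Lemma branch_above t : ~~ chain t ->
  entry (phi (e (nseq (size t) 0%N))) t != 0 -> exists eta, branch S eta.
Proof.
pose good t := ~~ chain t /\ entry (phi (e (nseq (size t) 0%N))) t != 0.
have step (x : {t | good t}) : {y : {t | good t} |
    behead (sval y) = sval x /\ size (sval y) = (size (sval x)).+1}.
  apply: cid; case: x => s [sN sv] /=.
  have : entry (push (phi (e (nseq (size s).+1 0%N)))) s != 0.
    by rewrite endo_push //; exact: based_nseq.
  case/entry_push_neq0 => u us uv.
  have uN : ~~ chain u by apply: contra sN; rewrite -us; exact: chain_behead.
  have sz : size u = (size s).+1 by case: u us uN uv => [|k u] //= ->.
  have gu : good u by split=> //; rewrite sz.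
  by exists (exist _ u gu).
(* [f] climbs from [t]; dropping [size t] entries at the tip of each [f n] leaves
   its initial segment of length [n]. *)
move=> tN tv; pose f n := sval (iter n (fun x => sval (step x)) (exist good t (conj tN tv))).
have fS n : behead (f n.+1) = f n /\ size (f n.+1) = (size (f n)).+1.
  exact: (svalP (step _)).
have fgood n : good (f n) by exact: svalP.
have fsz n : size (f n) = (size t + n)%N.
  by elim: n => [|n IH]; [rewrite addn0|rewrite (fS n).2 IH addnS].
have fSS n : S (f n).
  have [_ /endo_supported] := fgood n; apply; exact: based_nseq.
exists (fun n => drop (size t) (f n)) => n; split.
- by rewrite size_drop fsz addKn.
- exact: based_drop.
- by rewrite -(fS n).1 -!drop1 !drop_drop addnC.
move=> n0; apply/negP => cd.
have := based_off_chain S_based (fSS n); rewrite (negPf (fgood n).1) /=.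
have : 0%N \in drop (size t) (f n).
  have : size (drop (size t) (f n)) = n by rewrite size_drop fsz addKn.
  case: (drop _ _) cd => [|k s] /=; first by lia.
  by case/andP => /eqP-> _ _; rewrite inE.
by move/mem_drop => ->.
Qed.

Hypothesis no_branch : ~ exists eta, branch S eta.

(** By [branch_above] the images of the chain vectors are supported on the chain,
    and [push] makes the scalar the same at all levels. *)
Lemma endo_scalar_chain n : phi (e (nseq n 0%N)) = a *: e (nseq n 0%N).
Proof.
have on_chain m : phi (e (nseq m 0%N)) =
    entry (phi (e (nseq m 0%N))) (nseq m 0%N) *: e (nseq m 0%N).
  apply/vectP => t; rewrite entryZ entry_e; case: (_ =P t) => [->|tm]; first by rewrite mulr1.
  rewrite mulr0; apply/eqP; apply: contraT => tv.
  have st := endo_level (based_nseq m) tv; rewrite size_nseq in st.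
  case: no_branch; apply: (branch_above (t := t)); last by rewrite st.
  by rewrite chainE st eq_sym; apply/eqP.
elim: n => [|n IH]; first exact: endo_root.
have := endo_push (based_nseq n.+1) isT; rewrite on_chain linearZ /= push_e /= IH.
by move=> /(congr1 (entry^~ (nseq n 0%N))); rewrite !entryZ entry_e eqxx !mulr1 => ->.
Qed.

Lemma endo_scalar_e s : S s -> phi (e s) = a *: e s.
Proof.
move=> Ss; have [|/endo_scalar_off_chain->//] := boolP (chain s).
by rewrite chainE => /eqP ->; exact: endo_scalar_chain.
Qed.

(** Some multiple of [v] is an integral combination of basis vectors. *)
Lemma endo_scalar v : grp S v -> phi v = a *: v.
Proof.
move=> gv.
have [m m0 mi] : exists2 m : nat, (0 < m)%N &
    forall i : 'I_(size v), m%:R * entry v (CodeSeq.decode i) \is a Num.int.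
  exists (\prod_(i < size v) `|denq (entry v (CodeSeq.decode i))|)%N.
    by rewrite prodn_gt0 // => i; rewrite absz_gt0 denq_eq0.
  move=> i; rewrite (bigD1 i) //= natrM mulrAC rpredM ?natr_int //.
  rewrite -{2}[entry _ _]divq_num_den pmulrn absz_denq mulrC divfK ?intr_int //.
  by rewrite intr_eq0 denq_eq0.
have m_neq0 : (m%:R : rat) != 0 by rewrite pnatr_eq0 -lt0n.
apply: (scalerI m_neq0); rewrite -endoZ ?natr_int //.
rewrite [in LHS](vect_sum v) [in RHS](vect_sum v) scalerA mulrC -scalerA !scaler_sumr.
have gi (i : 'I_(size v)) : entry v (CodeSeq.decode i) != 0 ->
  S (CodeSeq.decode i) by case: gv => + _; apply.
rewrite endo_sum => [|i]; last first.
  have [->|/gi Si] := eqVneq (entry v (CodeSeq.decode i)) 0.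
    by rewrite scale0r scaler0; exact: grp0.
  by rewrite scalerA; apply: grpZint; [exact: mi|exact: grp_e].
apply: eq_bigr => i _; rewrite scalerA.
have [->|/gi Si] := eqVneq (entry v (CodeSeq.decode i)) 0.
  by rewrite mulr0 !scale0r scaler0 endo0.
rewrite endoZ; [|exact: mi|exact: grp_e].
by rewrite endo_scalar_e // !scalerA mulrC.
Qed.

(** At each prime the root or the first chain node survives in the quotient, where
    the group is integral. *)
Lemma endo_scalar_int : a \is a Num.int.
Proof.
apply: int_of_pint => p pp.
have [n sn] : exists n, quot (constraint_at p) (e (nseq n 0%N)) = e (nseq n 0%N).
  case: (constraint_at p) => [[|n]|u|n].
  - by exists 1%N; rewrite quot_e.
  - by exists 0%N; rewrite quot_e.
  - by exists 0%N; rewrite quot_e.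
  - by exists 0%N; rewrite quot_e.
have [_ /(_ p pp (nseq n 0%N))] := phi_grp (grp_e (based_nseq n)).
by rewrite endo_scalar_chain linearZ /= sn entryZ entry_e eqxx mulr1.
Qed.

End Endo.

Theorem automorphism_scalar S phi psi : based_tree S ->
  ~ (exists eta, branch S eta) ->
  (forall v, grp S v -> grp S (phi v)) -> (forall v, grp S v -> grp S (psi v)) ->
  (forall u v, grp S u -> grp S v -> phi (u + v) = phi u + phi v) ->
  (forall v, grp S v -> psi (phi v) = v) ->
  (forall v, grp S v -> phi (psi v) = v) ->
  (forall v, grp S v -> phi v = v) \/ (forall v, grp S v -> phi v = - v).
Proof.
move=> St nb phig psig phiD phiK psiK.
have psiD u v : grp S u -> grp S v -> psi (u + v) = psi u + psi v.
  move=> gu gv; rewrite -{1}(psiK u) // -{1}(psiK v) // -phiD; try exact: psig.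
  by rewrite phiK //; apply: grpD; exact: psig.
have ai := endo_scalar_int St phig phiD nb; have av := endo_scalar St phig phiD nb.
have bi := endo_scalar_int St psig psiD nb; have bv := endo_scalar St psig psiD nb.
move: ai av bi bv; set a := entry _ _; set b := entry _ _ => /intrP[x ->] av /intrP[y ->] bv.
have g0 : grp S (e [::]) by apply: grp_e; apply: (based_chain St).
have : y * x = 1.
  apply: (@intr_inj rat); rewrite intrM.
  have := phiK _ g0; rewrite bv; last exact: phig.
  rewrite av // scalerA => /(congr1 (entry^~ [::])).
  by rewrite entryZ entry_e /= mulr1.
move=> /intUnitRing.unitzPl /orP[] /eqP xE; [left|right] => v /av ->; rewrite xE ?scale1r //.
by rewrite mulrNz scaleN1r.
Qed.

(** * A branch gives an involution *)

Section Flip.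
Variables (S : set node) (eta : nat -> node).
Hypotheses (S_based : based_tree S) (eta_branch : branch S eta).

(** The lines of the branch nodes are prescribed, so that the branch cannot just be
    exchanged with the chain.  When its nodes are fixed, an involution can only
    send a chain vector to its opposite modulo them; the term [2 e(eta)] then
    keeps the sum of the coordinates, as compatibility with the fixed root
    requires. *)
Definition flip_gen (s : node) : vect :=
  if chain s then 2%:R *: e (eta (size s)) - e s else e s.
Definition flip : vect -> vect := lin flip_gen.
HB.instance Definition _ := GRing.Linear.on flip.

Lemma flip_e s : flip (e s) = flip_gen s.
Proof. exact: lin_e. Qed.

Lemma eta0 : eta 0 = [::].
Proof. by have [/size0nil] := eta_branch 0. Qed.

Lemma flip_root : flip (e [::]) = e [::].
Proof. by rewrite flip_e /flip_gen /= eta0 scaler_nat mulr2n addrK. Qed.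

Lemma flip_eta n : flip (e (eta n)) = e (eta n).
Proof.
case: n => [|n]; first by rewrite eta0 flip_root.
have [_ _ _ /(_ isT)] := eta_branch n.+1.
by rewrite flip_e /flip_gen => /negPf ->.
Qed.

Lemma flipK : involutive flip.
Proof.
move=> v; apply: (linear_ext (f := flip \o flip) (g := idfun)) => s _ /=.
rewrite [in LHS]flip_e /flip_gen; case: ifPn => [cs|/negPf sN].
  rewrite linearB linearZ /= flip_eta flip_e /flip_gen cs.
  by rewrite opprB addrC subrK.
by rewrite flip_e /flip_gen sN.
Qed.

Lemma intvect_flip_gen s : intvect (flip_gen s).
Proof.
rewrite /flip_gen; case: ifP => _ t; rewrite ?entryD ?entryZ ?entryN !entry_e.
  by rewrite rpredB ?rpredM ?natr_int.
by rewrite natr_int.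
Qed.

Lemma flip_supported v : supported S v -> supported S (flip v).
Proof.
move=> vs t; rewrite entry_lin => vt; apply: contrapT => St; case/eqP: vt.
apply: big1 => i _.
have [->|/vs Ss] := eqVneq (entry v (CodeSeq.decode i)) 0; first by rewrite mul0r.
rewrite /flip_gen; set s := CodeSeq.decode i in Ss *.
have off u : S u -> entry (e u) t = 0.
  by rewrite entry_e; case: (u =P t) => // ->.
have [_ Se _ _] := eta_branch (size s).
by case: ifP => _; rewrite ?entryD ?entryN ?entryZ !off // ?mulr0 ?subrr ?mulr0.
Qed.

(** Since [quot c] is idempotent, this says that [flip] preserves its kernel.  The
    delicate case is [Merge]: [eta] takes parents to parents as the chain does,
    and the one node of the chain with children outside it, the root, is fixed
    by [flip]. *)
Lemma quot_flip c s : S s -> quot c (flip (quot c (e s))) = quot c (flip (e s)).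
Proof.
move=> Ss; have [sz Se be eN] := eta_branch (size s).
case: c => [n|u|n].
- rewrite !quot_e /= /keep; case: ifPn => //.
  rewrite negbK => /eqP sn; rewrite !linear0 flip_e /flip_gen.
  case: ifP => _; rewrite ?linearB ?linearZ /= !quot_e /= /keep ?sz sn eqxx //=.
  by rewrite scaler0 subrr.
- rewrite !quot_e /= /keep; case: ifPn => //.
  rewrite negb_or negbK => /andP[sN /eqP su]; rewrite !linear0 flip_e /flip_gen.
  by rewrite (negPf sN) quot_e /= /keep su eqxx -su (negPf sN).
rewrite !quot_e /=; case: ifP => // /eqP sn.
case: s Ss sz Se be eN sn => // k s Ss /= sz Se be eN [sn].
rewrite !flip_e /flip_gen /=; have [cs|sN] := boolP (chain s).
  have [/andP[/eqP k0 _]|] := boolP ((k == 0%N) && chain s); last first.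
    move=> kN; have := based_off_chain S_based Ss; rewrite /= (negPf kN) /=.
    case: s cs kN {Ss sz Se be eN} sn => [|j s /= /andP[/eqP -> _] _]; last first.
      by rewrite !inE orbT.
    move=> _ kN /= <- _; rewrite eta0 scaler_nat mulr2n addrK.
    by rewrite (negPf kN) !quot_e.
  have [sz' _ be' _] := eta_branch (size s).
  rewrite k0 !linearB !linearZ /= !quot_e /= sz sz' be' sn eqxx.
  by case: eqP => //; lia.
rewrite andbF !quot_e /= sn eqxx.
by case: eqP => //; lia.
Qed.

(** By [quot_flip] the quotient of [flip v] is computed from the quotient of [v]
    by integral maps, and thus remains integral at [p]. *)
Lemma flip_grp v : grp S v -> grp S (flip v).
Proof.
move=> [vs vp]; split=> [|p pp]; first exact: flip_supported.
have -> : quot (constraint_at p) (flip v) =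
    quot (constraint_at p) (flip (quot (constraint_at p) v)).
  apply: (linear_ext (f := quot (constraint_at p) \o flip)
    (g := quot (constraint_at p) \o (flip \o quot (constraint_at p)))) => s /vs Ss.
  exact/esym/quot_flip.
apply: pintvect_lin; first exact: intvect_quot_gen.
by apply: pintvect_lin; [exact: intvect_flip_gen|exact: vp].
Qed.

Lemma flip_chain1 : flip (e [:: 0%N]) != e [:: 0%N].
Proof.
apply/eqP => /(congr1 (entry^~ [:: 0%N])).
have [_ _ _ /(_ isT) etaN] := eta_branch 1.
rewrite flip_e /flip_gen /= entryD entryN entryZ !entry_e eqxx.
by case: eqP etaN => [->|_] //; lra.
Qed.

End Flip.

(** * Transporting the group of a tree to the natural numbers *)

Lemma inj_unbounded (f : nat -> nat) : injective f ->
  forall n, exists k, (n <= f k)%N.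
Proof.
move=> finj n; apply: contrapT => /forallNP H.
have lt_f k : (f k < n)%N by rewrite ltnNge; apply/negP.
have := @leq_card 'I_n.+1 'I_n (fun k => Ordinal (lt_f k)).
rewrite !card_ord ltnn => /(_ _)/negP; apply => // i j /(congr1 val) /= /finj.
exact: val_inj.
Qed.

Section Enumeration.
Variable S : set node.

(** [rk] and [en] are the inverse bijections between [grp S] and [nat] obtained by
    counting the codes of the elements of the group. *)
Definition rk (v : vect) : nat := rank [set pickle w | w in grp S] (pickle v).

Definition en (k : nat) : vect := xget 0 [set v | grp S v /\ rk v = k].

Hypothesis S_based : based_tree S.

Lemma rk_inj u v : grp S u -> grp S v -> rk u = rk v -> u = v.
Proof.
move=> gu gv E; apply: (pcan_inj pickleK).
by apply: (rank_inj _ _ E); [exists u|exists v].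
Qed.

Lemma en_spec k : grp S (en k) /\ rk (en k) = k.
Proof.
have [] : exists v, grp S v /\ rk v = k.
  have [|m [v gv <-] rm] := @rank_surj [set pickle w | w in grp S] _ k.
    move=> n; have [|j nj] := @inj_unbounded (fun j => pickle (e [::] *+ j)) _ n.
      move=> i j /(pcan_inj pickleK)/(congr1 (entry^~ [::])).
      rewrite -!scaler_nat !entryZ entry_e eqxx !mulr1 => /eqP.
      by rewrite eqr_nat => /eqP.
    exists (pickle (e [::] *+ j)) => //; exists (e [::] *+ j) => //.
    by apply: grpMn; apply: grp_e; exact: (based_chain S_based).
  by exists v.
by move=> v vP; apply: (@xgetPex _ 0 [set v | grp S v /\ rk v = k]); exists v.
Qed.

Lemma en_grp k : grp S (en k). Proof. exact: (en_spec k).1. Qed.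
Lemma enK : cancel en rk. Proof. by move=> k; exact: (en_spec k).2. Qed.
Lemma rkK v : grp S v -> en (rk v) = v.
Proof. by move=> gv; apply: rk_inj => //; [exact: en_grp|exact: enK]. Qed.

Definition group_structure : structure :=
  ((fun ab : nat * nat => rk (en ab.1 + en ab.2)), (fun a => rk (- en a)), rk 0).

Notation M := group_structure.

Lemma en_add a b : en (sadd M a b) = en a + en b.
Proof. by rewrite rkK //; apply: grpD; exact: en_grp. Qed.

Lemma en_opp a : en (sopp M a) = - en a.
Proof. by rewrite rkK //; apply: grpN; exact: en_grp. Qed.

Lemma en_zero : en (szero M) = 0.
Proof. by rewrite rkK //; exact: grp0. Qed.

Lemma group_structure_TFAB : TFAB M.
Proof.
have en_inj := can_inj enK.
split; first split.
- by move=> a b c; apply: en_inj; rewrite !en_add addrA.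
- by move=> a b; apply: en_inj; rewrite !en_add addrC.
- by move=> a; apply: en_inj; rewrite en_add en_zero add0r.
- by move=> a; apply: en_inj; rewrite en_add en_opp en_zero addNr.
move=> n x n0 H; apply: en_inj; rewrite en_zero.
have en_iter k : en (iter k (sadd M x) (szero M)) = en x *+ k.
  by elim: k => [|k IH]; rewrite ?en_zero // iterS en_add IH mulrS.
have := en_iter n; rewrite H en_zero => /esym/eqP.
by rewrite -scaler_nat scaler_eq0 pnatr_eq0 -(negbK (n == 0)%N) -lt0n n0 => /eqP.
Qed.

Definition group_tfab : TFAB := SigSub (mem_set group_structure_TFAB).

Lemma transport_Aut (f g : vect -> vect) :
  (forall v, grp S v -> grp S (f v)) -> (forall v, grp S v -> grp S (g v)) ->
  (forall v, grp S v -> g (f v) = v) -> (forall v, grp S v -> f (g v) = v) ->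
  {morph f : u v / u + v} -> Aut M (rk \o f \o en).
Proof.
move=> fg gg fK gK fD; split.
  exists (rk \o g \o en) => k /=.
    by rewrite rkK ?fK ?enK //; [exact: en_grp|apply: fg; exact: en_grp].
  by rewrite rkK ?gK ?enK //; [exact: en_grp|apply: gg; exact: en_grp].
move=> a b /=; apply: (can_inj enK).
have gf k : grp S (f (en k)) by apply: fg; exact: en_grp.
by rewrite en_add !rkK // ?en_add ?fD //; exact: grpD.
Qed.

Theorem rigid_group_tfab :
  rigid group_tfab <-> ~ exists eta, branch S eta.
Proof.
have en_inj := can_inj enK.
have S0 n : grp S (e (nseq n 0%N)) by apply: grp_e; exact: based_nseq.
rewrite /rigid /= /set_val /= -/M; split=> [AutM [eta eta_br]|nb].
  have: Aut M (rk \o flip eta \o en).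
    apply: (transport_Aut (g := flip eta)).
    - exact: (flip_grp S_based eta_br).
    - exact: (flip_grp S_based eta_br).
    - by move=> v _; exact: (flipK eta_br).
    - by move=> v _; exact: (flipK eta_br).
    - by move=> u v; exact: linearD.
  rewrite AutM /= => -[H|H].
    have := congr1 (@^~ (rk (e [:: 0%N]))) H; rewrite /= rkK; last exact: (S0 1%N).
    move=> /(congr1 en); rewrite !rkK; last 2 first.
      exact: (S0 1%N).
      by apply: (flip_grp S_based eta_br); exact: (S0 1%N).
    by apply/eqP; exact: flip_chain1.
  have := congr1 (@^~ (rk (e [::]))) H; rewrite /= rkK; last exact: (S0 0%N).
  rewrite (flip_root eta_br) => /(congr1 en); rewrite en_opp !rkK; last exact: (S0 0%N).
  by move=> /(congr1 (entry^~ [::])); rewrite entryN entry_e => /eqP.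
apply/seteqP; split=> f /=; last first.
  case=> ->; first by split; [exists idfun|].
  split; last by move=> a b; apply: en_inj; rewrite !(en_opp, en_add) opprD.
  by exists (sopp M) => a; apply: en_inj; rewrite !en_opp opprK.
case=> -[g fK gK] fD.
have en_f a b : en (f (rk (en a + en b))) = en (f a) + en (f b).
  by rewrite -[rk _]/(sadd M a b) fD en_add.
have [] := @automorphism_scalar S (en \o f \o rk) (en \o g \o rk) S_based nb.
- by move=> v _; exact: en_grp.
- by move=> v _; exact: en_grp.
- by move=> u v gu gv /=; rewrite -{1}(rkK gu) -{1}(rkK gv) en_f.
- by move=> v gv /=; rewrite enK fK rkK.
- by move=> v gv /=; rewrite enK gK rkK.
- move=> H; left; apply/funext => a; apply: en_inj.
  by have := H _ (en_grp a); rewrite /= enK.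
- move=> H; right; apply/funext => a; apply: en_inj.
  by have := H _ (en_grp a); rewrite /= enK en_opp.
Qed.

End Enumeration.

(** * Closed families of integer sequences as Polish spaces *)

(** A type [X] is given by countably many natural numbers [o x k] attached to each
    [x : X], which determine [x]; it becomes an ultrametric space, which is
    complete when the image of [X] in [K -> nat] is closed. *)
Section Observables.
Variables (X : Type) (K : countType) (o : X -> K -> nat).

(** The first [n] observations, along the enumeration of [K]; [pickle_inv] is
    partial, hence the default. *)
Definition prefix (n : nat) (x : X) : seq nat :=
  mkseq (fun i => oapp (o x) 0%N (pickle_inv i)) n.

Lemma eq_prefixP n x y : prefix n x = prefix n y <->
  forall k, (pickle k < n)%N -> o x k = o y k.
Proof.
split=> [E k kn|H].
  by have := congr1 (fun s => nth 0%N s (pickle k)) E; rewrite !nth_mkseq // pickleK_inv.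
apply: (@eq_from_nth _ 0%N); rewrite !size_mkseq // => i ltin.
rewrite !nth_mkseq //; have := @pickle_invK K i.
by case: (pickle_inv i) => [k|] //= ik; apply: H; rewrite ik.
Qed.

Lemma eq_prefix_le m n x y : (m <= n)%N ->
  prefix n x = prefix n y -> prefix m x = prefix m y.
Proof.
by move=> mn /eq_prefixP H; apply/eq_prefixP => k km; apply: H; exact: leq_trans mn.
Qed.

Definition cylinder (s : seq nat) : set X := [set x | prefix (size s) x = s].

Lemma near_prefix (U : topologicalType) (f : U -> X) u n :
  (forall k, \forall v \near u, o (f v) k = o (f u) k) ->
  \forall v \near u, prefix n (f u) = prefix n (f v).
Proof.
move=> H; elim: n => [|n IH]; first by apply: filterE => v.
have pn : \forall v \near u,
    oapp (o (f u)) 0%N (pickle_inv n) = oapp (o (f v)) 0%N (pickle_inv n).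
  case: (pickle_inv n) => [k|] /=; last by apply: filterE.
  by apply: filterS (H k) => v ->.
by apply: filterS2 IH pn => v E1 E2; rewrite /prefix !mkseqS -!/(prefix _ _) E1 E2.
Qed.

Hypothesis o_inj : forall x y, o x =1 o y -> x = y.

Lemma neq_prefix x y : x <> y -> exists n, prefix n x != prefix n y.
Proof.
move=> xy; apply: contrapT => /forallNP H; apply: xy; apply: o_inj => k.
have /negP := H (pickle k).+1; rewrite negbK => /eqP /eq_prefixP; exact.
Qed.

Variable R : realType.

(** The minimum is at least [1], prefixes of length [0] being equal. *)
Definition obs_dist (x y : X) : R :=
  if pselect (exists n, prefix n x != prefix n y) is left ex
  then (ex_minn ex)%:R^-1 else 0.

Variant obs_dist_spec x y : R -> Prop :=
 | ObsDistEq of x = y : obs_dist_spec x y 0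
 | ObsDistNeq n of x <> y & prefix n x = prefix n y
    & prefix n.+1 x <> prefix n.+1 y : obs_dist_spec x y n.+1%:R^-1.

Lemma obs_distP x y : obs_dist_spec x y (obs_dist x y).
Proof.
rewrite /obs_dist; case: pselect => [ex|H]; last first.
  by apply: ObsDistEq; apply: contrapT => /neq_prefix.
case: ex_minnP => -[|n] /eqP nxy nmin; first by [].
apply: ObsDistNeq => //; first by move=> E; apply: nxy; rewrite E.
by apply/eqP; apply: contraT => /nmin; rewrite ltnn.
Qed.

(** The metric is only used through this equivalence. *)
Lemma obs_dist_le n x y : obs_dist x y <= n.+1%:R^-1 <-> prefix n x = prefix n y.
Proof.
case: obs_distP => [->|m _ E N]; first by split=> // _; rewrite invr_ge0.
rewrite lef_pV2 ?posrE ?ltr0n // ler_nat ltnS; split=> [nm|E'].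
  exact: eq_prefix_le E.
by rewrite leqNgt; apply/negP => mn; apply: N; apply: eq_prefix_le E'.
Qed.

Lemma obs_dist_ge0 x y : 0 <= obs_dist x y.
Proof. by case: obs_distP => // *; rewrite invr_ge0. Qed.

Lemma obs_distxx x : obs_dist x x = 0.
Proof. by case: obs_distP. Qed.

Lemma obs_dist0 x y : obs_dist x y = 0 -> x = y.
Proof.
case: obs_distP => // n _ _ _ /eqP.
by rewrite invr_eq0 pnatr_eq0.
Qed.

Lemma obs_dist_sym x y : obs_dist x y = obs_dist y x.
Proof.
have key a b : obs_dist b a <= obs_dist a b.
  case: (obs_distP a b) => [->|n _ E _]; first by rewrite obs_distxx.
  by apply/obs_dist_le.
by apply/eqP; rewrite eq_le !key.
Qed.

Lemma obs_dist_ultra y x z :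
  obs_dist x z <= Num.max (obs_dist x y) (obs_dist y z).
Proof.
have key a b c : obs_dist b c <= obs_dist a b -> obs_dist a c <= obs_dist a b.
  case: (obs_distP a b) => [->|n _ E _]; first by rewrite le_eqVlt ltNge obs_dist_ge0 orbF => /eqP->.
  by move=> /obs_dist_le E'; apply/obs_dist_le; rewrite E.
rewrite le_max; case: (leP (obs_dist y z) (obs_dist x y)) => [/key->//|/ltW H].
apply/orP; right; rewrite obs_dist_sym [leRHS]obs_dist_sym; apply: key.
by rewrite obs_dist_sym [leRHS]obs_dist_sym.
Qed.

Lemma obs_dist_triangle y x z :
  obs_dist x z <= obs_dist x y + obs_dist y z.
Proof.
apply: (le_trans (obs_dist_ultra y x z)).
by rewrite ge_max lerDl lerDr !obs_dist_ge0.
Qed.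

End Observables.

Definition obs_space (R : realType) (X : Type) (K : countType)
  (o : X -> K -> nat) (o_inj : forall x y, o x =1 o y -> x = y) : Type := X.

Section ObsSpace.
Variables (R : realType) (X : Type) (K : countType).
Variables (o : X -> K -> nat) (o_inj : forall x y, o x =1 o y -> x = y).
Local Notation T := (obs_space R o_inj).

HB.instance Definition _ := gen_eqMixin T.
HB.instance Definition _ := gen_choiceMixin T.
HB.instance Definition _ := @isMetric.Build R T (@obs_dist X K o R)
  (obs_distxx o_inj R) (@obs_dist0 X K o o_inj R) (@obs_dist_sym X K o o_inj R)
  (@obs_dist_triangle X K o o_inj R).

Lemma natSinv_lt (r : R) : 0 < r -> exists n : nat, n.+1%:R^-1 < r.
Proof.
move=> r0; have [n _ /(_ n (leqnn n))] := near_infty_natSinv_lt (PosNum r0).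
by exists n.
Qed.

Lemma obs_nbhsP (x : T) (A : set T) :
  nbhs x A <-> exists n, [set y | prefix o n x = prefix o n y] `<=` A.
Proof.
rewrite -metricType_numDomainType.filter_from_mdist_nbhs; split.
  move=> [r r0 rA]; have [n nr] := natSinv_lt r0.
  exists n => y /(obs_dist_le o_inj R) xy; apply: rA; exact: le_lt_trans nr.
move=> [n nA]; exists n.+1%:R^-1; first by rewrite /= invr_gt0 ltr0n.
by move=> y /ltW /(obs_dist_le o_inj R) /nA.
Qed.

Lemma near_obs (x : T) k : \forall y \near x, o y k = o x k.
Proof.
by apply/obs_nbhsP; exists (pickle k).+1 => y /eq_prefixP /(_ k (ltnSn _)) ->.
Qed.

Lemma obs_near (U : topologicalType) (f : U -> T) u :
  (forall k, \forall v \near u, o (f v) k = o (f u) k) -> {for u, continuous f}.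
Proof.
by move=> H A /obs_nbhsP[n nA]; apply: filterS (near_prefix n H) => v /nA.
Qed.

(** Cylinders are indexed by the countable type [seq nat], so this expresses open
    sets as countable unions. *)
Lemma obs_open_cylinders (U : set T) : open U ->
  U = \bigcup_(s in [set s | cylinder o s `<=` U]) cylinder o s.
Proof.
move=> Uo; apply/seteqP; split=> [x Ux|x [s sU]]; last exact: sU.
have /obs_nbhsP[n nU] : nbhs x U by apply: open_nbhs_nbhs.
exists (prefix o n x); last by rewrite /cylinder /= size_mkseq.
by move=> y; rewrite /cylinder /= size_mkseq => E; apply: nU; rewrite /= E.
Qed.

Lemma obs_separable : separable T.
Proof.
have [x0|X0] := pselect (exists x : T, True); last first.
  exists set0; split=> //; move=> O [x]; by case: X0; exists x.
have pick (s : seq nat) : {x : T | forall y, cylinder o s y -> cylinder o s x}.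
  apply: cid; have [[y ys]|H] := pselect (exists y, cylinder o s y); first by exists y.
  by case: x0 => x _; exists x => y ys; case: H; exists y.
exists (range (fun s => sval (pick s))); split.
  by apply: (card_le_trans (card_image_le _ _)); exact: countableP.
move=> O [x Ox] /obs_open_cylinders OE; move: (Ox); rewrite {1}OE => -[s sO xs].
exists (sval (pick s)); split; last by exists s.
by apply: sO; exact: (svalP (pick s) x xs).
Qed.

Hypothesis o_closed : forall (x : nat -> X) (z : K -> nat),
  (forall k, \forall n \near \oo, o (x n) k = z k) -> exists l, o l =1 z.

(** A Cauchy filter eventually decides each observation; the decided values are a
    pointwise limit of observations of points of [X]. *)
Lemma obs_complete : complete_metric T.
Proof.
move=> F FF /cauchyP Fc.
have Fk k : exists m, F [set x : T | o x k = m].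
  have [x Fx] := Fc (pickle k).+2%:R^-1 ltac:(by rewrite invr_gt0 ltr0n).
  exists (o x k); apply: filterS Fx => y; rewrite ballEmdist /= => /ltW.
  by move=> /(obs_dist_le o_inj R) /eq_prefixP /(_ k (ltnSn _)) ->.
have [z Fz] := choice Fk.
have Fn n : F [set x : T | forall k, (pickle k < n)%N -> o x k = z k].
  elim: n => [|n IH]; first by apply: filterE => x /= k.
  case E : (pickle_inv n : option K) => [k|]; last first.
    apply: filterS IH => x H k; rewrite ltnS leq_eqVlt => /orP[/eqP kn|/H//].
    by move: E; rewrite -kn pickleK_inv.
  apply: filterS2 IH (Fz k) => x H xk j; rewrite ltnS leq_eqVlt => /orP[/eqP jn|/H//].
  by move: E; rewrite -jn pickleK_inv => -[->].
have ex n : exists x : T, forall k, (pickle k < n)%N -> o x k = z k.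
  exact: filter_ex (Fn n).
have [x xz] := choice ex.
have [|l lz] := o_closed (x := x) (z := z).
  by move=> k; exists (pickle k).+1 => // n /= kn; apply: xz.
exists l => A /obs_nbhsP[n nA]; apply: filterS (Fn n) => y yz.
by apply: nA; apply/eq_prefixP => k kn; rewrite yz // lz.
Qed.

Lemma obs_polish : polish T.
Proof. by split; [exact: obs_complete|exact: obs_separable]. Qed.

End ObsSpace.

(** * The Polish space of torsion-free abelian groups *)

Definition sobs (M : structure) (k : nat * nat + nat + unit) : nat :=
  match k with
  | inl (inl ab) => M.1.1 ab
  | inl (inr a) => M.1.2 a
  | inr _ => M.2
  end.

Lemma sobs_inj M N : sobs M =1 sobs N -> M = N.
Proof.
case: M N => [[m1 m2] m3] [[n1 n2] n3] H.
congr (_, _, _); last exact: (H (inr tt)).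
  by apply/funext => ab; exact: (H (inl (inl ab))).
by apply/funext => a; exact: (H (inl (inr a))).
Qed.

Lemma near_eq_nat (U : topologicalType) (f : U -> nat) u :
  {for u, continuous f} -> \forall v \near u, f v = f u.
Proof. by move=> fc; exact: (fc [set f u] (discrete_set1 (f u))). Qed.

Lemma near_sobs (M : structure) k : \forall N \near M, sobs N k = sobs M k.
Proof.
apply: near_eq_nat; case: k => [[ab|a]|[]] /=.
- apply: (@continuous_comp _ _ _ (fun M : structure => M.1.1) (proj ab)).
    apply: (@continuous_comp _ _ _ fst fst); exact: cvg_fst.
  exact: proj_continuous.
- apply: (@continuous_comp _ _ _ (fun M : structure => M.1.2) (proj a)).
    apply: (@continuous_comp _ _ _ fst snd); [exact: cvg_fst|exact: cvg_snd].
  exact: proj_continuous.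
exact: cvg_snd.
Qed.

Lemma sobs_near (U : topologicalType) (f : U -> structure) u :
  (forall k, \forall v \near u, sobs (f v) k = sobs (f u) k) ->
  {for u, continuous f}.
Proof.
move=> H.
have H1 : (fun v => (f v).1.1) @ u --> (f u).1.1.
  apply/pointwise_cvgP => ab; apply/discrete_cvg; exact: (H (inl (inl ab))).
have H2 : (fun v => (f v).1.2) @ u --> (f u).1.2.
  apply/pointwise_cvgP => a; apply/discrete_cvg; exact: (H (inl (inr a))).
have H3 : (fun v => (f v).2) @ u --> (f u).2.
  apply/discrete_cvg; exact: (H (inr tt)).
have := cvg_pair (cvg_pair H1 H2) H3.
rewrite /prop_for /continuous_at.
have -> : (fun v => ((f v).1.1, (f v).1.2, (f v).2)) = f.
  by apply/funext => v; case: (f v) => [[]].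
by case: (f u) => [[a b] c] Hf; exact: Hf.
Qed.

Definition tobs (G : TFAB) := sobs (set_val G).

Lemma tobs_inj G H : tobs G =1 tobs H -> G = H.
Proof. by move=> /sobs_inj /val_inj. Qed.

Definition tfab_space (R : realType) := obs_space R tobs_inj.

(** Each instance of an axiom involves finitely many values of the operations. *)
Lemma TFAB_eventually (x : nat -> structure) (M : structure) :
  (forall n, TFAB (x n)) ->
  (forall k, \forall n \near \oo, sobs (x n) k = sobs M k) -> TFAB M.
Proof.
move=> xT xM.
have nadd a b : \forall n \near \oo, sadd (x n) a b = sadd M a b.
  exact: (xM (inl (inl (a, b)))).
have nopp a : \forall n \near \oo, sopp (x n) a = sopp M a.
  exact: (xM (inl (inr a))).
have nzero : \forall n \near \oo, szero (x n) = szero M.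
  exact: (xM (inr tt)).
split; first split.
- move=> a b c; near \oo => n; have [[xA _ _ _] _] := xT n.
  have <- : sadd (x n) a (sadd M b c) = sadd M a (sadd M b c) by near: n.
  have <- : sadd (x n) (sadd M a b) c = sadd M (sadd M a b) c by near: n.
  have <- : sadd (x n) a b = sadd M a b by near: n.
  have <- : sadd (x n) b c = sadd M b c by near: n.
  exact: xA.
- move=> a b; near \oo => n; have [[_ xC _ _] _] := xT n.
  have <- : sadd (x n) a b = sadd M a b by near: n.
  have <- : sadd (x n) b a = sadd M b a by near: n.
  exact: xC.
- move=> a; near \oo => n; have [[_ _ x0 _] _] := xT n.
  have <- : sadd (x n) (szero M) a = sadd M (szero M) a by near: n.
  have <- : szero (x n) = szero M by near: n.
  exact: x0.
- move=> a; near \oo => n; have [[_ _ _ xN] _] := xT n.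
  have <- : sadd (x n) (sopp M a) a = sadd M (sopp M a) a by near: n.
  have <- : sopp (x n) a = sopp M a by near: n.
  have <- : szero (x n) = szero M by near: n.
  exact: xN.
move=> m a m0.
have niter j : \forall n \near \oo,
    iter j (sadd (x n) a) (szero (x n)) = iter j (sadd M a) (szero M).
  elim: j => [|j IH]; first exact: nzero.
  apply: filterS2 IH (nadd a (iter j (sadd M a) (szero M))) => n E1 E2.
  by rewrite !iterS E1 E2.
near \oo => n; have [_ xF] := xT n.
have <- : iter m (sadd (x n) a) (szero (x n)) = iter m (sadd M a) (szero M).
  by near: n.
have <- : szero (x n) = szero M by near: n.
exact: xF.
Unshelve. all: by end_near. Qed.

Lemma tobs_closed (x : nat -> TFAB) (z : (nat * nat + nat + unit)%type -> nat) :
  (forall k, \forall n \near \oo, tobs (x n) k = z k) -> exists G, tobs G =1 z.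
Proof.
move=> H.
pose M : structure :=
  ((fun ab => z (inl (inl ab))), (fun a => z (inl (inr a))), z (inr tt)).
have Mz k : sobs M k = z k by case: k => [[]|[]].
have MT : TFAB M.
  apply: (@TFAB_eventually (fun n => set_val (x n))).
    by move=> n; exact: set_valP.
  by move=> k; rewrite Mz; exact: H.
by exists (SigSub (mem_set MT)).
Qed.

Section Coanalytic.
Variable R : realType.
Local Notation T := (tfab_space R).

Lemma tfab_polish : polish T.
Proof. exact: (@obs_polish R _ _ _ tobs_inj tobs_closed). Qed.

Lemma set_val_continuous : continuous (set_val : T -> structure).
Proof. by move=> G; apply: sobs_near => k; exact: near_obs. Qed.

Lemma structure_cylinder_open (s : seq nat) :
  open (cylinder sobs s : set structure).
Proof.
rewrite openE => M /= Ms.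
apply: filterS (near_prefix (size s) (f := idfun) (near_sobs M)) => N E.
by rewrite /cylinder /= -E.
Qed.

Lemma tfab_open_trace (U : set T) : open U ->
  exists2 W : set structure, open W & U = set_val @^-1` W.
Proof.
move=> Uo.
exists (\bigcup_(s in [set s | cylinder tobs s `<=` U])
  (cylinder sobs s)).
  by apply: bigcup_open => s _; exact: structure_cylinder_open.
by rewrite {1}(obs_open_cylinders Uo).
Qed.

(** The metric topology and that of the space of structures are both generated by
    the values of the operations; on [TFAB] their open sets coincide
    ([tfab_open_trace] and [set_val_continuous]), and so do the generated
    sigma-algebras. *)
Lemma borel_tfabP (C : set T) : borel C <-> TFAB_borel C.
Proof.
split.
  apply: smallest_sub.
    by apply: sigma_algebra_preimage; exact: smallest_sigma_algebra.
  move=> U /tfab_open_trace[W Wo ->]; exists W; last by rewrite setTI.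
  exact: sub_sigma_algebra.
move=> [B + <-]; rewrite setTI.
move: B; apply: (@smallest_sub _ _ _ [set B | borel (set_val @^-1` B : set T)]).
  have [b0 bC bU] := smallest_sigma_algebra [set: T] open.
  split; first by rewrite /= preimage_set0.
    by move=> A /bC; rewrite /= setTD setTD.
  by move=> A /bU; rewrite /= preimage_bigcup.
move=> W Wo; apply: sub_sigma_algebra.
by apply: open_comp Wo => G _; exact: set_val_continuous.
Qed.

Lemma tfab_borel_iso : borel_iso TFAB_borel (idfun : TFAB -> T).
Proof. by split; [exists idfun|exact: borel_tfabP]. Qed.

End Coanalytic.

(** * Rigidity is co-analytic *)

(** The inverse is part of the data so that bijectivity is a closed condition. *)
Record flexible := Flexible {
  fx_group : TFAB;
  fx_fun : nat -> nat;
  fx_inv : nat -> nat;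
  fx_moved : nat;
  fx_unopposed : nat }.

Definition fx_wf (q : flexible) : Prop :=
  [/\ cancel (fx_fun q) (fx_inv q), cancel (fx_inv q) (fx_fun q),
      {morph fx_fun q : a b / sadd (set_val (fx_group q)) a b},
      fx_fun q (fx_moved q) != fx_moved q &
      fx_fun q (fx_unopposed q) != sopp (set_val (fx_group q)) (fx_unopposed q)].

Lemma TFAB_aut (G : TFAB) :
  [set idfun; sopp (set_val G)] `<=` Aut (set_val G).
Proof.
have [[A C l0 lN] _] : TFAB (set_val G) by exact: set_valP.
set M := set_val G in A C l0 lN *.
have r0 a : sadd M a (szero M) = a by rewrite C l0.
have rN a : sadd M a (sopp M a) = szero M by rewrite C lN.
have cancelR a b c : sadd M a c = sadd M b c -> a = b.
  by move=> E; rewrite -[a]r0 -[b]r0 -(rN c) !A E.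
have NK : involutive (sopp M).
  by move=> a; apply: (cancelR _ _ (sopp M a)); rewrite lN rN.
move=> f /= [->|->]; first by split; [exists idfun|].
split; first by exists (sopp M).
move=> a b; apply: (cancelR _ _ (sadd M a b)); rewrite lN.
by rewrite [sadd M (sopp M a) _]C -A [sadd M (sopp M a) _]A lN l0 lN.
Qed.

Lemma not_rigidP (G : TFAB) :
  ~ rigid G <-> exists q : {q : flexible | fx_wf q}, fx_group (sval q) = G.
Proof.
split=> [nr|[[q [fK gK fD m u]] /= <-] r]; last first.
  have : Aut (set_val (fx_group q)) (fx_fun q) by split; [exists (fx_inv q)|].
  rewrite r /= => -[E|E]; first by rewrite E eqxx in m.
  by rewrite E eqxx in u.
have [f [fA fN]] : exists f, Aut (set_val G) f /\ ~ [set idfun; sopp (set_val G)] f.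
  apply: contrapT => /forallNP H; apply: nr; apply/seteqP; split; last exact: TFAB_aut.
  by move=> f fA; apply: contrapT => fN; apply: (H f).
have [a fa] : exists a, f a != a.
  apply: contrapT => /forallNP H; apply: fN; left; apply/funext => a.
  by apply/eqP; rewrite -[_ == _]negbK; apply/negP; exact: H.
have [b fb] : exists b, f b != sopp (set_val G) b.
  apply: contrapT => /forallNP H; apply: fN; right; apply/funext => b.
  by apply/eqP; rewrite -[_ == _]negbK; apply/negP; exact: H.
case: fA => -[g fK gK] fD.
by exists (exist fx_wf (Flexible G f g a b) (And5 fK gK fD fa fb)).
Qed.

Definition fx_obs (q : {q : flexible | fx_wf q})
  (k : (nat * nat + nat + unit) + (nat + nat) + bool) : nat :=
  match k with
  | inl (inl k) => tobs (fx_group (sval q)) k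
  | inl (inr (inl a)) => fx_fun (sval q) a
  | inl (inr (inr a)) => fx_inv (sval q) a
  | inr true => fx_moved (sval q)
  | inr false => fx_unopposed (sval q)
  end.

Lemma fx_obs_inj p q : fx_obs p =1 fx_obs q -> p = q.
Proof.
case: p q => [[G f g a b] p] [[G' f' g' a' b'] q] H; apply: eq_exist => /=.
have -> : G = G' by apply: tobs_inj => k; exact: (H (inl (inl k))).
have -> : f = f' by apply/funext => c; exact: (H (inl (inr (inl c)))).
have -> : g = g' by apply/funext => c; exact: (H (inl (inr (inr c)))).
by have -> : a = a' := H (inr true); have -> : b = b' := H (inr false).
Qed.

Lemma fx_obs_closed (x : nat -> {q : flexible | fx_wf q}) z :
  (forall k, \forall n \near \oo, fx_obs (x n) k = z k) ->
  exists q, fx_obs q =1 z.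
Proof.
move=> H.
have [|G Gz] := @tobs_closed (fun n => fx_group (sval (x n))) (fun k => z (inl (inl k))).
  by move=> k; exact: (H (inl (inl k))).
pose q := Flexible G (fun a => z (inl (inr (inl a)))) (fun a => z (inl (inr (inr a))))
  (z (inr true)) (z (inr false)).
pose y n := sval (x n).
have nadd a b : \forall n \near \oo,
    sadd (set_val (fx_group (y n))) a b = sadd (set_val G) a b.
  have := H (inl (inl (inl (inl (a, b))))); apply: filterS => n E.
  exact: etrans E (esym (Gz (inl (inl (a, b))))).
have nopp a : \forall n \near \oo,
    sopp (set_val (fx_group (y n))) a = sopp (set_val G) a.
  have := H (inl (inl (inl (inr a)))); apply: filterS => n E.
  exact: etrans E (esym (Gz (inl (inr a)))).
have nf a : \forall n \near \oo, fx_fun (y n) a = fx_fun q a.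
  exact: (H (inl (inr (inl a)))).
have ng a : \forall n \near \oo, fx_inv (y n) a = fx_inv q a.
  exact: (H (inl (inr (inr a)))).
have nm : \forall n \near \oo, fx_moved (y n) = fx_moved q.
  exact: (H (inr true)).
have nu : \forall n \near \oo, fx_unopposed (y n) = fx_unopposed q.
  exact: (H (inr false)).
have yP n : fx_wf (y n) by exact: svalP.
have qP : fx_wf q.
  split.
  - move=> a; near \oo => n; have [yK _ _ _ _] := yP n.
    have <- : fx_inv (y n) (fx_fun q a) = fx_inv q (fx_fun q a) by near: n.
    have <- : fx_fun (y n) a = fx_fun q a by near: n.
    exact: yK.
  - move=> a; near \oo => n; have [_ yK _ _ _] := yP n.
    have <- : fx_fun (y n) (fx_inv q a) = fx_fun q (fx_inv q a) by near: n.
    have <- : fx_inv (y n) a = fx_inv q a by near: n.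
    exact: yK.
  - move=> a b; near \oo => n; have [_ _ yD _ _] := yP n.
    have <- : fx_fun (y n) (sadd (set_val G) a b) = fx_fun q (sadd (set_val G) a b).
      by near: n.
    have <- : sadd (set_val (fx_group (y n))) a b = sadd (set_val G) a b by near: n.
    have <- : sadd (set_val (fx_group (y n))) (fx_fun q a) (fx_fun q b) =
      sadd (set_val G) (fx_fun q a) (fx_fun q b) by near: n.
    have <- : fx_fun (y n) a = fx_fun q a by near: n.
    have <- : fx_fun (y n) b = fx_fun q b by near: n.
    exact: yD.
  - near \oo => n; have [_ _ _ ym _] := yP n.
    have <- : fx_fun (y n) (fx_moved q) = fx_fun q (fx_moved q) by near: n.
    by have <- : fx_moved (y n) = fx_moved q by near: n.
  - near \oo => n; have [_ _ _ _ yu] := yP n.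
    have <- : fx_fun (y n) (fx_unopposed q) = fx_fun q (fx_unopposed q) by near: n.
    have <- : sopp (set_val (fx_group (y n))) (fx_unopposed q) =
      sopp (set_val G) (fx_unopposed q) by near: n.
    by have <- : fx_unopposed (y n) = fx_unopposed q by near: n.
by exists (exist fx_wf q qP) => -[[k|[a|a]]|[]] //=; exact: Gz.
Unshelve. all: by end_near. Qed.

Lemma rigid_coanalytic (R : realType) : coanalytic R TFAB_borel rigid.
Proof.
exists (tfab_space R), idfun; split; [exact: tfab_polish|exact: tfab_borel_iso|].
exists (obs_space R fx_obs_inj), (fun q => fx_group (sval q)).
split.
- exact: (@obs_polish R _ _ _ fx_obs_inj fx_obs_closed).
- move=> q; apply: obs_near => k.
  exact: (near_obs (q : obs_space R fx_obs_inj) (inl (inl k))).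
apply/seteqP; split=> [_ [q _ <-]|_ [G nr <-]].
  exists (fx_group (sval q)) => //; apply/not_rigidP; by exists q.
by have /not_rigidP[q qG] := nr; exists q.
Qed.

(** * Analytic sets as projections of branches *)

Section Souslin.
Variables (R : realType) (P T : metricType R) (f : P -> T).
Variables (D : set P) (g : P -> nat).
Hypotheses (D_dense : dense D) (g_inj : {in D &, injective g}).
Hypotheses (P_complete : complete_metric P) (f_cont : continuous f).

(** The head [k] of [k :: s'] names a point of the dense set, used as centre of a
    ball whose radius decreases with the length.  Names are successors, which
    keeps [0] for the chain. *)
Fixpoint cell (s : node) : set P :=
  if s is k :: s' then
    cell s' `&` [set x | exists d, [/\ D d, (g d).+1 = k &
                                   ball d (size s').+1%:R^-1 x]]
  else setT.

Lemma cell_behead s : cell s `<=` cell (behead s).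
Proof. by case: s => // k s x []. Qed.

Lemma cell_no_zero s x : cell s x -> 0%N \notin s.
Proof. by elim: s => // k s IH [/IH sN [d [_ <- _]]]; rewrite inE. Qed.

Definition souslin_tree (t : T) : set node :=
  [set s | chain s \/ closure (f @` cell s) t].

Lemma souslin_tree_based t : based_tree (souslin_tree t).
Proof.
split=> s.
- case=> [cs|ts]; first by left; exact: chain_behead.
  right; apply: closure_subset ts; apply: image_subset; exact: cell_behead.
- by left.
case=> [->//|ts]; apply/orP; right.
by have [y [[x xs _] _]] := ts setT filterT; exact: cell_no_zero xs.
Qed.

Lemma range_branch t : range f t -> exists eta, branch (souslin_tree t) eta.
Proof.
move=> [x _ <-].
have ex i : exists k, exists d, [/\ D d, (g d).+1 = k & ball d i.+1%:R^-1 x].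
  have [d [dx Dd]] : (ball x i.+1%:R^-1)° `&` D !=set0.
    apply: D_dense; last exact: open_interior.
    by exists x; apply: nbhsx_ballx; rewrite invr_gt0 ltr0n.
  exists (g d).+1, d; split=> //; apply: ball_sym; exact: interior_subset dx.
have [kap kapP] := choice ex.
pose eta n : node := iteri n (fun i s => kap i :: s) [::].
have sz n : size (eta n) = n by elim: n => //= n ->.
have xn n : cell (eta n) x by elim: n => //= n IH; split; rewrite // sz.
exists eta => n; split=> //.
  by right; apply: subset_closure; exists x.
case: n => // n _; apply/negP => /= /andP[/eqP k0 _].
by have [d [_ + _]] := kapP n; rewrite k0.
Qed.

(** The cells along a branch are nonempty of vanishing diameter, hence shrink to a
    point [l]; by continuity [f l] and [t] cannot be separated. *)
Lemma branch_range t : (exists eta, branch (souslin_tree t) eta) -> range f t.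
Proof.
move=> [eta br].
have sz n : size (eta n) = n by have [] := br n.
have be n : behead (eta n.+1) = eta n by have [] := br n.
have tc n : closure (f @` cell (eta n.+1)) t.
  by have [_ [cs|//] _ /(_ isT)/negP] := br n.+1.
have cell_le m n : (m <= n)%N -> cell (eta n) `<=` cell (eta m).
  move=> /subnKC <-; elim: (n - m)%N => [|j IH]; first by rewrite addn0.
  by rewrite addnS => x /cell_behead; rewrite be; exact: IH.
have ctr n : exists d, cell (eta n.+1) `<=` ball d n.+1%:R^-1.
  have := be n; have := sz n.+1; case E : (eta n.+1) => [//|k s] _ /= sE.
  have [y [[x /= ++] _]] := tc n setT filterT; rewrite E => -[_ [d [Dd dk _]]] _.
  exists d => z [_ [d' [Dd' dk' zd']]].
  have <- : d' = d by apply: g_inj; rewrite ?inE //; apply: succn_inj; rewrite dk dk'.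
  by rewrite sE sz in zd'.
have [d dP] := choice ctr.
have ex n : exists x, cell (eta n.+1) x.
  by have [y [[x xs _] _]] := tc n setT filterT; exists x.
have [x xP] := choice ex.
have [l xl] : exists l : P, x @ \oo --> l.
  apply: P_complete; apply/cauchyP => eps eps0; have [n nr] := natSinv_lt eps0.
  exists (d n), n => // m /= nm.
  by apply: le_ball (ltW nr) _ _; apply: dP; apply: cell_le (xP m).
exists l => //; apply: (@metric_hausdorff _ T) => A B Ag Bt.
have /nbhs_ballP[r /= r0 rA] := f_cont Ag.
have r3 : 0 < r / 3 by rewrite divr_gt0 // ltr0n.
have [n nr] := natSinv_lt r3.
have [m mr mn] : exists2 m, ball l (r / 3) (x m) & (n <= m)%N.
  have [N _ NP] : \forall m \near \oo, ball l (r / 3) (x m).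
    by apply: xl; exact: nbhsx_ballx.
  by exists (maxn N n); [apply: NP; rewrite /= leq_maxl|rewrite leq_maxr].
have [y [[z zn <-] Bz]] := tc n B Bt.
exists (f z); split=> //; apply: rA.
(* Going from [l] to [z] through [x m] and [d n] costs less than [r / 3] three
   times. *)
have xm : ball (d n) n.+1%:R^-1 (x m) by apply: dP; apply: cell_le (xP m).
have := ball_triangle mr (ball_triangle (ball_sym xm) (dP n z zn)).
apply: le_ball; move: nr; move: (n.+1%:R^-1) => q /ltW; lra.
Qed.

Lemma souslin_tree_borel s : borel [set t | souslin_tree t s].
Proof.
have [b0 bC bU] := smallest_sigma_algebra [set: T] open.
have [cs|cs] := boolP (chain s).
  suff -> : [set t | souslin_tree t s] = setT `\` set0 by exact: bC.
  by rewrite setD0; apply/seteqP; split=> // t _; left.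
have -> : [set t | souslin_tree t s] = setT `\` ~` closure (f @` cell s).
  rewrite setTD setCK; apply/seteqP; split=> t; last by right.
  by case=> //; rewrite (negPf cs).
by apply: bC; apply: sub_sigma_algebra; rewrite openC; exact: closed_closure.
Qed.

End Souslin.

(** * Borel dependence of the group on the tree *)

Section BorelPredicates.
Variable T : topologicalType.

Lemma borel_setC (A : set T) : borel A -> borel (~` A).
Proof.
have [_ bC _] := smallest_sigma_algebra [set: T] open.
by move=> /bC; rewrite setTD.
Qed.

Lemma borel_const (Q : Prop) : borel [set t : T | Q].
Proof.
have [b0 _ _] := smallest_sigma_algebra [set: T] open.
have [q|nq] := pselect Q; last first.
  by rewrite (_ : [set _ | _] = set0) //; apply/seteqP; split=> t.
rewrite (_ : [set _ | _] = ~` set0); first exact: borel_setC.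
by rewrite setC0; apply/seteqP; split=> t.
Qed.

Lemma borel_exists (I : countType) (Q : I -> T -> Prop) :
  (forall i, borel [set t | Q i t]) -> borel [set t | exists i, Q i t].
Proof.
move=> bQ; have [_ _ bU] := smallest_sigma_algebra [set: T] open.
rewrite (_ : [set _ | _] = \bigcup_n
    (if unpickle n is Some i then [set t | Q i t] else set0)).
  by apply: bU => n; case: unpickle => [i|]; [exact: bQ|exact: borel_const False].
apply/seteqP; split=> t /=.
  by move=> [i Qi]; exists (pickle i) => //; rewrite pickleK.
by move=> [n _]; case: unpickle => // i Qi; exists i.
Qed.

Lemma borel_not (Q : T -> Prop) : borel [set t | Q t] -> borel [set t | ~ Q t].
Proof. exact: borel_setC. Qed.

Lemma borel_forall (I : countType) (Q : I -> T -> Prop) :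
  (forall i, borel [set t | Q i t]) -> borel [set t | forall i, Q i t].
Proof.
move=> bQ; rewrite (_ : [set _ | _] = [set t | ~ exists i, ~ Q i t]).
  by apply: borel_not; apply: borel_exists => i; apply: borel_not.
apply/seteqP; split=> t /=; first by move=> Qt [i]; apply.
by move=> /forallNP H i; apply: contrapT; exact: H.
Qed.

Lemma borel_or (Q Q' : T -> Prop) : borel [set t | Q t] ->
  borel [set t | Q' t] -> borel [set t | Q t \/ Q' t].
Proof.
move=> bQ bQ'; rewrite (_ : [set _ | _] = [set t | exists b : bool, if b then Q t else Q' t]).
  by apply: borel_exists => -[].
apply/seteqP; split=> t /=; first by case=> H; [exists true|exists false].
by case=> -[]; [left|right].
Qed.

Lemma borel_and (Q Q' : T -> Prop) : borel [set t | Q t] ->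
  borel [set t | Q' t] -> borel [set t | Q t /\ Q' t].
Proof.
move=> bQ bQ'; rewrite (_ : [set _ | _] = [set t | forall b : bool, if b then Q t else Q' t]).
  by apply: borel_forall => -[].
apply/seteqP; split=> t /=; first by move=> [q q'] [].
by move=> H; split; [exact: (H true)|exact: (H false)].
Qed.

Lemma borel_implies (Q Q' : T -> Prop) : borel [set t | Q t] ->
  borel [set t | Q' t] -> borel [set t | Q t -> Q' t].
Proof.
move=> bQ bQ'; rewrite (_ : [set _ | _] = [set t | ~ Q t \/ Q' t]).
  by apply: borel_or => //; exact: borel_not.
apply/seteqP; split=> t /=; last by case.
by have [q H|nq _] := pselect (Q t); [right; exact: H|left].
Qed.

End BorelPredicates.

Section GroupBorel.
Variables (T : topologicalType) (S : T -> set node).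
Hypothesis S_based : forall t, based_tree (S t).
Hypothesis S_borel : forall s, borel [set t | S t s].

Lemma grp_borel v : borel [set t | grp (S t) v].
Proof.
apply: borel_and; last exact: borel_const.
apply: borel_forall => s; apply: borel_implies; first exact: borel_const.
exact: S_borel.
Qed.

Lemma rank_borel (A : T -> set nat) : (forall m, borel [set t | A t m]) ->
  forall n k, borel [set t | rank (A t) n = k].
Proof.
move=> Ab; elim=> [|n IH] k; first by rewrite /rank /=; exact: borel_const.
rewrite (_ : [set _ | _] = [set t | A t n /\ (exists j, rank (A t) n = j /\ j.+1 = k)
   \/ ~ A t n /\ rank (A t) n = k]).
  apply: borel_or; apply: borel_and => //; last exact: borel_not.
  by apply: borel_exists => j; apply: borel_and => //; exact: borel_const.
apply/seteqP; split=> t /=; rewrite rankS; case: asboolP => At.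
- by rewrite addn1 => <-; left; split=> //; exists (rank (A t) n).
- by rewrite addn0 => <-; right.
- by case=> [[_ [j [-> <-]]]|[]//]; rewrite addn1.
- by case=> [[]//|[_ ->]]; rewrite addn0.
Qed.

Lemma rk_borel v k : borel [set t | rk (S t) v = k].
Proof.
apply: rank_borel => m; rewrite (_ : [set _ | _] =
  [set t | exists w, grp (S t) w /\ pickle w = m]).
  apply: borel_exists => w; apply: borel_and; [exact: grp_borel|exact: borel_const].
by apply/seteqP; split=> t /= [w]; [move=> gw <-|case=> gw <-]; exists w.
Qed.

(** The inverse of the bijection [rk] has the same graph. *)
Lemma en_borel k v : borel [set t | en (S t) k = v].
Proof.
rewrite (_ : [set _ | _] = [set t | grp (S t) v /\ rk (S t) v = k]).
  by apply: borel_and; [exact: grp_borel|exact: rk_borel].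
apply/seteqP; split=> t /=.
  by move=> <-; split; [exact: en_grp|exact: enK].
by move=> [gv <-]; exact: rkK.
Qed.

Lemma tobs_group_borel k c :
  borel [set t | tobs (group_tfab (S_based t)) k = c].
Proof.
case: k => [[[a b]|a]|[]].
- rewrite (_ : [set _ | _] = [set t | exists u v : vect,
      en (S t) a = u /\ (en (S t) b = v /\ rk (S t) (u + v) = c)]).
    apply: borel_exists => u; apply: borel_exists => v.
    by do 2![apply: borel_and; first exact: en_borel]; exact: rk_borel.
  apply/seteqP; split=> t /=; first by move=> E; exists (en (S t) a), (en (S t) b).
  by move=> [u [v [<- [<- E]]]].
- rewrite (_ : [set _ | _] = [set t | exists u : vect,
      en (S t) a = u /\ rk (S t) (- u) = c]).
    apply: borel_exists => u.
    by apply: borel_and; [exact: en_borel|exact: rk_borel].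
  apply/seteqP; split=> t /=; first by move=> E; exists (en (S t) a).
  by move=> [u [<- E]].
exact: rk_borel.
Qed.

(** Open sets are countable unions of cylinders, which are finite conjunctions of
    conditions on the operations. *)
Lemma group_borel (R : realType) (C : set (tfab_space R)) : borel C ->
  borel [set t | C (group_tfab (S_based t))].
Proof.
move: C; apply: (@smallest_sub _ _ _
  [set C : set (tfab_space R) | borel [set t | C (group_tfab (S_based t))]]).
  have [b0 bC bU] := smallest_sigma_algebra [set: T] open.
  split; first exact: b0.
    by move=> C; exact: bC.
  by move=> C /bU; rewrite /bigcup.
move=> U Uo; rewrite /= (obs_open_cylinders Uo).
rewrite (_ : [set _ | _] = [set t | exists s, cylinder tobs s `<=` U /\
  forall i, (i < size s)%N ->
    oapp (tobs (group_tfab (S_based t))) 0%N (pickle_inv i) = nth 0%N s i]).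
  apply: borel_exists => s; apply: borel_and; first exact: borel_const.
  apply: borel_forall => i; apply: borel_implies; first exact: borel_const.
  by case: (pickle_inv i) => [k|] /=; [exact: tobs_group_borel|exact: borel_const].
apply/seteqP; split=> t /=.
  move=> [s sU st]; exists s; split=> // i si.
  by rewrite -[in RHS]st nth_mkseq.
move=> [s [sU H]]; exists s => //; apply: (@eq_from_nth _ 0%N); rewrite size_mkseq // => i si.
by rewrite nth_mkseq // H.
Qed.

End GroupBorel.

Theorem theorem1p4 (R : realType) : complete_coanalytic R TFAB_borel rigid.
Proof.
split; first exact: rigid_coanalytic.
move=> Y SY B _ [T [h [_ [h_bij hSY] [P [f [[P_complete [D [D_countable D_dense]]] f_cont fB]]]]]].
have [g g_inj] := countable_injP _ D_countable.
have S_based := souslin_tree_based f D g.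
have S_borel := souslin_tree_borel f D g.
exists (fun y => group_tfab (S_based (h y))); split.
  move=> C /(borel_tfabP (R := R)) Cb.
  exact: (hSY _).1 (group_borel S_based S_borel Cb).
apply/seteqP; split=> y.
  move=> By; apply/(rigid_group_tfab (S_based (h y))).
  move=> /(branch_range g_inj P_complete f_cont); rewrite fB => -[y' nB].
  by move=> /(bij_inj h_bij) E; apply: nB; rewrite E.
move=> /(rigid_group_tfab (S_based (h y))) nb; apply: contrapT => nB.
by apply: nb; apply: range_branch => //; rewrite fB; exists y.
Qed.
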